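(* Let $q$, $m$ and $n$ be positive integers such that $q$ is odd and $nm$ is even. Then \[ \sum_{k = 1}^\infty \frac{(-1)^{k-1}}{\prod_{j=0}^{m-1} F_{nk+njq}\,\prod_{j=m+1}^{2m} F_{nk+njq}} = \frac{1}{L_{mnq}}\sum_{k=1}^{q}\frac{(-1)^{k-1}}{\prod_{j=0}^{2m-1}F_{nk+njq}}. \]
   Context: The Fibonacci numbers are defined by $F_0=0$, $F_1=1$, $F_n=F_{n-1}+F_{n-2}$, and the Lucas numbers by $L_0=2$, $L_1=1$, $L_n=L_{n-1}+L_{n-2}$. Infinite sums are limits of partial sums. *)

(* Defs.v *)
From mathcomp Require Import all_boot.

Set Implicit Arguments.
Unset Strict Implicit.
Unset Printing Implicit Defensive.

Fixpoint fib (n : nat) : nat :=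
  match n with
  | 0 => 0
  | 1 => 1
  | (k.+1 as p).+1 => fib p + fib k
  end.

Fixpoint lucas (n : nat) : nat :=
  match n with
  | 0 => 2
  | 1 => 1
  | (k.+1 as p).+1 => lucas p + lucas k
  end.

(* Main.v *)
Require Import Defs.
From mathcomp Require Import all_boot all_order all_algebra.
From mathcomp Require Import all_classical all_reals all_analysis.
From mathcomp Require Import ring.

(** Write [a_j = F_(nk+njq)] and [g k = (-1)^(k-1) / (a_0 ... a_(2m-1))].  Shifting
    [k] by [q] turns [a_j] into [a_(j+1)] and, [q] being odd, flips the sign, so
    [g k - g (k+q)] equals [(-1)^(k-1) (a_0 + a_(2m)) / (a_0 ... a_(2m))].  As [mnq]
    is even, [a_0 + a_(2m) = L_(mnq) a_m], which cancels the factor [a_m] missing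
    on the left-hand side.  The series thus telescopes with step [q], and
    [g k] tends to 0. *)

Set Implicit Arguments.
Unset Strict Implicit.
Unset Printing Implicit Defensive.

Import Order.TTheory GRing.Theory Num.Theory.
Import numFieldNormedType.Exports.

Local Open Scope classical_set_scope.
Local Open Scope ring_scope.

Lemma fibSS n : fib n.+2 = (fib n.+1 + fib n)%N.
Proof. by []. Qed.

Lemma lucasSS n : lucas n.+2 = (lucas n.+1 + lucas n)%N.
Proof. by []. Qed.

Lemma fib_gt0 n : (0 < n)%N -> (0 < fib n)%N.
Proof.
suff /andP[f1 _] : (0 < fib n.-1.+1)%N && (0 < fib n.-1.+2)%N by move/prednK <-.
elim: n.-1 => // k /andP[f0 f1]; rewrite f1 fibSS; exact: ltn_addr.
Qed.

(** A crude linear bound, enough to compare [g] with the harmonic sequence; [n <= fib n] already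
    fails at [n = 2]. *)
Lemma leq_pred_fib n : (n.-1 <= fib n)%N.
Proof.
case: n => [|[|n]] //; elim: n => // n IHn.
by rewrite fibSS; have := leq_add IHn (fib_gt0 (ltn0Sn n)); rewrite addn1.
Qed.

Lemma lucas_gt0 n : (0 < lucas n)%N.
Proof.
suff /andP[] : (0 < lucas n)%N && (0 < lucas n.+1)%N by [].
elim: n => // n /andP[l0 l1]; rewrite l1 lucasSS; exact: ltn_addr.
Qed.

(** Both sides obey a second-order recurrence in [r], so the induction carries two consecutive
    cases; [x] stays general because the step uses them at [x.+1] and [x.+2]. *)
Lemma lucas_fib (R : comNzRingType) r x :
  (lucas r)%:R * (fib (x + r))%:R
    = (fib (x + r.*2))%:R + (-1) ^+ r * (fib x)%:R :> R.
Proof.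
suff [] : (forall x, (lucas r)%:R * (fib (x + r))%:R
    = (fib (x + r.*2))%:R + (-1) ^+ r * (fib x)%:R :> R) /\
  (forall x, (lucas r.+1)%:R * (fib (x + r.+1))%:R
    = (fib (x + r.+1.*2))%:R + (-1) ^+ r.+1 * (fib x)%:R :> R) by [].
elim: r {x} => [|r [IH0 IH1]]; split=> // x.
- by rewrite double0 addn0 /lucas; ring.
- by rewrite addn1 addn2 fibSS natrD /lucas; ring.
have := IH1 x.+1; have := IH0 x.+2.
rewrite lucasSS natrD mulrDl !doubleS !addSn !addnS => -> ->.
rewrite (fibSS (x + r.*2).+2) (fibSS x) !natrD !exprS; ring.
Qed.

(** Splitting the sum of the first [N + q] values of [g] at [N] or at [q] gives the same total. No
    comparison between [N] and [q] is required. *)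
Lemma sum_telescope_step (V : zmodType) (g : nat -> V) q N :
  \sum_(0 <= k < N) (g k - g (k + q)%N) = \sum_(0 <= k < q) (g k - g (k + N)%N).
Proof.
have split_sum a b : \sum_(0 <= k < a + b) g k
    = \sum_(0 <= k < a) g k + \sum_(0 <= k < b) g (k + a)%N.
  by rewrite (@big_cat_nat _ _ _ a) ?leq_addr //= -{2}[a]add0n big_addn addKn.
have := split_sum N q; rewrite addnC split_sum !sumrB => E.
by apply/eqP; rewrite subr_eq addrAC eq_sym subr_eq E addrC.
Qed.

(** Each product on the left is the full product of [a 0], ..., [a (2 * m)] with one end factor
    removed. *)
Lemma shifted_prod_diff (F : fieldType) (a : nat -> F) (s L : F) m :
  (forall j, a j != 0) -> a 0%N + a (2 * m)%N = L * a m ->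
  s / \prod_(0 <= j < 2 * m) a j + s / \prod_(0 <= j < 2 * m) a j.+1
    = L * (s / (\prod_(0 <= j < m) a j * \prod_(m.+1 <= j < (2 * m).+1) a j)).
Proof.
move=> a_neq0 aL.
have prod_neq0 u v : \prod_(u <= j < v) a j != 0.
  by rewrite prodf_seq_neq0; apply/allP => j _; rewrite a_neq0.
have le_m2m : (m <= 2 * m)%N by rewrite leq_pmull.
pose A := \prod_(0 <= j < m) a j; pose B := \prod_(m.+1 <= j < (2 * m).+1) a j.
have prodE : \prod_(0 <= j < (2 * m).+1) a j = A * a m * B.
  by rewrite (@big_cat_nat _ _ _ m.+1) //= big_nat_recr.
have -> : \prod_(0 <= j < 2 * m) a j = A * a m * B / a (2 * m)%N.
  by rewrite -prodE big_nat_recr //= mulfK.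
have -> : \prod_(0 <= j < 2 * m) a j.+1 = A * a m * B / a 0%N.
  by rewrite -prodE big_nat_recl //= mulrC mulKf.
have -> : L = (a 0%N + a (2 * m)%N) / a m by rewrite aL mulfK.
rewrite -/A -/B; field.
by rewrite !a_neq0 !prod_neq0.
Qed.

Theorem theorem2p7 (R : realType) (q m n : nat)
    (q_gt0 : (0 < q)%N) (m_gt0 : (0 < m)%N) (n_gt0 : (0 < n)%N)
    (q_odd : odd q) (nm_even : ~~ odd (n * m)) :
  (\sum_(1 <= k < N.+1)
      (-1) ^+ (k - 1) /
      (\prod_(0 <= j < m) (fib (n * k + n * j * q))%:R *
       \prod_(m.+1 <= j < (2 * m).+1) (fib (n * k + n * j * q))%:R) : R)
    @[N --> \oo]
  --> (((lucas (m * n * q))%:R)^-1 *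
      \sum_(1 <= k < q.+1)
        (-1) ^+ (k - 1) /
        \prod_(0 <= j < 2 * m) (fib (n * k + n * j * q))%:R : R).
Proof.
pose a k j : R := (fib (n * k + n * j * q))%:R.
(* Indexed from 0, one below the summation index, so every Fibonacci index is positive and no
   denominator vanishes. *)
pose g k : R := (-1) ^+ k / \prod_(0 <= j < 2 * m) a k.+1 j.
have fib_arg_gt0 k j : (0 < fib (n * k.+1 + n * j * q))%N.
  by rewrite fib_gt0 // addn_gt0 muln_gt0 n_gt0.
have a_neq0 k j : a k.+1 j != 0 by rewrite pnatr_eq0 -lt0n.
have L_neq0 : (lucas (m * n * q))%:R != 0 :> R by rewrite pnatr_eq0 -lt0n lucas_gt0.
have a_mid k : a k 0%N + a k (2 * m)%N = (lucas (m * n * q))%:R * a k m.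
  (* [lucas_fib] at [x = n * k], [r = m * n * q]; its sign is [+1] since [r] is even. *)
  rewrite /a (mulnC n m) lucas_fib -signr_odd oddM (mulnC m n) (negbTE nm_even).
  by rewrite expr0 mul1r addrC muln0 mul0n addn0 -mul2n; congr ((fib _)%:R + _); ring.
have gB k : g k - g (k + q)%N = (lucas (m * n * q))%:R * ((-1) ^+ k /
    (\prod_(0 <= j < m) a k.+1 j * \prod_(m.+1 <= j < (2 * m).+1) a k.+1 j)).
  rewrite -shifted_prod_diff // /g exprD -[(-1) ^+ q]signr_odd q_odd expr1 mulrN1.
  rewrite mulNr opprK; congr (_ + _ / _); apply: eq_bigr => j _.
  by rewrite /a; congr ((fib _)%:R); ring.
(* Only the [q] terms [g (k + N)] still depend on [N]. *)
have sumE N : \sum_(1 <= k < N.+1) (-1) ^+ (k - 1) /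
      (\prod_(0 <= j < m) a k j * \prod_(m.+1 <= j < (2 * m).+1) a k j)
    = ((lucas (m * n * q))%:R)^-1 * \sum_(0 <= k < q) (g k - g (k + N)%N).
  rewrite -sum_telescope_step mulr_sumr big_add1; apply: eq_bigr => k _.
  by rewrite subn1 gB mulKf.
have g_cvg0 : g @ \oo --> (0 : R).
  (* The shift by 1 absorbs the loss in [leq_pred_fib]: [n * (k + 2) - 1 >= k + 1] bounds
     [g (k + 1)] by [1 / (k + 1)]. *)
  apply: norm_cvg0; rewrite -(cvg_shiftn 1).
  apply: (squeeze_cvgr _ (cvg_cst 0) cvg_harmonic).
  apply: nearW => k /=; rewrite normr_ge0 /g normrM normrX normrN1 expr1n mul1r.
  rewrite /a -natr_prod normfV ger0_norm // lef_pV2 ?qualifE /= ?ltr0n ?prodn_gt0 //.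
  rewrite ler_nat.
  (* As [m > 0], the factor [j = 0] can be split off; the others are at least 1. *)
  have -> : (2 * m)%N = (2 * m).-1.+1 by rewrite prednK // muln_gt0.
  rewrite big_nat_recl // addn1 muln0 mul0n addn0.
  apply: leq_trans (leq_pmulr _ _); last exact: prodn_gt0.
  apply: leq_trans (leq_pred_fib _).
  by rewrite -ltnS prednK ?muln_gt0 ?n_gt0 // leq_pmull.
under eq_fun do rewrite sumE.
apply: cvgMl_tmp.
rewrite [X in _ --> X](_ : _ = \sum_(0 <= k < q) (g k - 0)); last first.
  by rewrite big_add1; apply: eq_bigr => k _; rewrite subn1 subr0.
apply: cvg_big => [|k _]; first exact: add_continuous.
apply: cvgB; first exact: cvg_cst.
have := g_cvg0; rewrite -(cvg_shiftn k); under eq_fun do rewrite addnC.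
exact.
Qed.
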